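(* Let $(X,G)$ be a $G$-metric space, let $m\ge 1$, let $X_1,\dots,X_m$ be nonempty subsets of $X$, and let $T:\bigcup_{i=1}^m X_i\to\bigcup_{i=1}^m X_i$ be a G-Mohseni-semi cyclical operator with constant $\alpha\in(0,\frac12)$. Then for every $\epsilon>0$, $$\delta(F_G^{\epsilon}(T))\le \epsilon\,\frac{2+\alpha}{1-\alpha}.$$
   Context: A $G$-metric on a nonempty set $X$ is a function $G:X\times X\times X\to[0,\infty)$ such that: (G1) $G(x,y,z)=0$ if and only if $x=y=z$; (G2) $0<G(x,x,y)$ for all $x,y\in X$ with $x\neq y$; (G3) $G(x,x,y)\le G(x,y,z)$ for all $x,y,z\in X$ with $z\ne y$; (G4) $G$ is symmetric in its three variables (invariant under all permutations of its arguments); (G5) $G(x,y,z)\le G(x,a,a)+G(a,y,z)$ for all $x,y,z,a\in X$. The pair $(X,G)$ is called a $G$-metric space (completeness is not assumed). With the convention $X_{m+1}=X_1$, a map $T:\bigcup_{i=1}^m X_i\to\bigcup_{i=1}^m X_i$ is a cyclical operator if $T(X_i)\subseteq X_{i+1}$ for all $i=1,\dots,m$. A G-Mohseni-semi cyclical operator with constant $\alpha\in(0,\frac12)$ is a cyclical operator $T$ such that for all $i\in\{1,\dots,m\}$, $x\in X_i$, $y\in X_{i+1}$, $$G(Tx,Ty,Ty)+G(Ty,Tx,Tx)\le \alpha\,\big([G(x,y,y)+G(y,x,x)]+[G(x,Tx,Tx)+G(Tx,x,x)]\big).$$ For $\epsilon>0$, $F_G^{\epsilon}(T)$ denotes the set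 of $\epsilon$-fixed points of $T$, i.e. the set of $x\in\bigcup_{i=1}^m X_i$ with $G(x,Tx,Tx)+G(Tx,x,x)<\epsilon$. Its diameter is $\delta(F_G^{\epsilon}(T))=\sup\{G(x,y,z): x,y,z\in F_G^{\epsilon}(T)\}$. *)

(* Defs.v *)
From mathcomp Require Import all_boot all_order all_algebra.
From mathcomp Require Import all_classical all_reals ereal.
Set Implicit Arguments.
Unset Strict Implicit.
Unset Printing Implicit Defensive.
Import Order.TTheory GRing.Theory Num.Theory.
Local Open Scope classical_set_scope.
Local Open Scope ring_scope.

Record G_metric (R : realType) (X : Type) (G : X -> X -> X -> R) : Prop := {
  G_inhabited : inhabited X ;
  G_ge0 : forall x y z, 0 <= G x y z ;
  G_eq0 : forall x y z, G x y z = 0 <-> x = y /\ y = z ;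
  G_gt0 : forall x y, x <> y -> 0 < G x x y ;
  G_le : forall x y z, z <> y -> G x x y <= G x y z ;
  G_sym : forall x y z,
    [/\ G x y z = G x z y, G x y z = G y x z, G x y z = G y z x,
        G x y z = G z x y & G x y z = G z y x] ;
  G_rectangle : forall x y z a, G x y z <= G x a a + G a y z
}.

Definition cyclic_union (X : Type) (m : nat) (Xs : 'I_m -> set X) : set X :=
  \bigcup_(i in [set: 'I_m]) Xs i.

(* [ordS] is the successor modulo m, so the last set is followed by the
   first one. *)
Definition cyclical (X : Type) (m : nat) (Xs : 'I_m -> set X)
    (T : {fun cyclic_union Xs >-> cyclic_union Xs}) : Prop :=
  forall i, T @` Xs i `<=` Xs (ordS i).

Definition G_Mohseni_semi_cyclical (R : realType) (X : Type)
    (G : X -> X -> X -> R) (m : nat) (Xs : 'I_m -> set X) (alpha : R)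
    (T : {fun cyclic_union Xs >-> cyclic_union Xs}) : Prop :=
  cyclical T /\
  forall (i : 'I_m) (x y : X), Xs i x -> Xs (ordS i) y ->
    G (T x) (T y) (T y) + G (T y) (T x) (T x) <=
    alpha * ((G x y y + G y x x) + (G x (T x) (T x) + G (T x) x x)).

Definition eps_fixed (R : realType) (X : Type) (G : X -> X -> X -> R)
    (m : nat) (Xs : 'I_m -> set X)
    (T : {fun cyclic_union Xs >-> cyclic_union Xs}) (eps : R) : set X :=
  [set x | cyclic_union Xs x /\ G x (T x) (T x) + G (T x) x x < eps].

(* Extended-real valued, so that bounding it includes boundedness of G on F. *)
Definition G_diameter (R : realType) (X : Type) (G : X -> X -> X -> R)
    (F : set X) : \bar R :=
  ereal_sup [set r | exists x y z, [/\ F x, F y, F z & r = (G x y z)%:E]].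

(* Main.v *)
Require Import Defs.
From mathcomp Require Import all_boot all_order all_algebra.
From mathcomp Require Import all_classical all_reals ereal.
From mathcomp Require Import topology normedtype sequences.
From mathcomp Require Import lra.
Import Order.TTheory GRing.Theory Num.Theory.
Import numFieldNormedType.Exports.
Local Open Scope classical_set_scope.
Local Open Scope ring_scope.

(** Put [d x y = G x y y + G y x x], which is a metric for which the hypothesis
    on [T] reads [d (T x) (T y) <= alpha * (d x y + d x (T x))] for [x] and [y]
    in consecutive sets.

    The diameter of the set of eps-fixed points for [G] is at most its diameter
    for [d]: the rectangle inequality can be centred at any of the three points,
    and the average of the three bounds is a third of the perimeter of the
    triangle for [d] ([G_le_perimeter]).

    If [x] and [y] lie in consecutive sets, then
    [d x y <= d x (T x) + d (T x) (T y) + d (T y) y] and the hypothesis on [T]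
    already give the constant [(2 + alpha) / (1 - alpha)].  Two eps-fixed points
    may however lie in arbitrary sets [X_i] and [X_j], and the hypothesis then
    says nothing about the pair.  They are compared through almost fixed points
    instead.  Applied to [w] and [T w], the hypothesis shows that every step of
    an orbit is at most [2 * alpha < 1] times the previous one; going around the
    cycle, each set thus contains points [w] with [d w (T w)] as small as one
    likes ([exists_almost_fixed]), and the orbit of such a point moves very
    little while it visits all the sets ([Gdist_iter]).

    Take an almost fixed [w] in the set that precedes the one of [x].  The
    hypothesis for the pair [(w, x)], in this order, involves the displacement
    of [w] and not that of [x], so that [d w x] is at most
    [(eps + small) / (1 - alpha)] ([Gdist_almost_fixed]).  Some iterate of [w]
    plays the same role for [y].  Hence [d x y <= (2 * eps + small) / (1 - alpha)],
    and the error is absorbed by the term [alpha * eps / (1 - alpha)]. *)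

(** * The metric associated with a G-metric *)

Definition Gdist {R : realType} {X : Type} (G : X -> X -> X -> R) (x y : X) : R :=
  G x y y + G y x x.

Lemma GdistC {R : realType} {X : Type} (G : X -> X -> X -> R) (x y : X) :
  Gdist G x y = Gdist G y x.
Proof. by rewrite /Gdist addrC. Qed.

Lemma Gdist_ge0 {R : realType} {X : Type} {G : X -> X -> X -> R}
    (hG : G_metric G) (x y : X) : 0 <= Gdist G x y.
Proof. by rewrite addr_ge0 // (G_ge0 hG). Qed.

Lemma Gdistxx {R : realType} {X : Type} {G : X -> X -> X -> R}
    (hG : G_metric G) (x : X) : Gdist G x x = 0.
Proof. by rewrite /Gdist (proj2 (G_eq0 hG x x x)) ?addr0. Qed.

Lemma Gdist_triangle {R : realType} {X : Type} {G : X -> X -> X -> R}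
    (hG : G_metric G) (y x z : X) : Gdist G x z <= Gdist G x y + Gdist G y z.
Proof.
rewrite /Gdist.
have := G_rectangle hG x z z y.
have := G_rectangle hG z x x y.
lra.
Qed.

(** Centring the rectangle inequality at one vertex gives a bound by two of the
    six values [G u v v]; over the three vertices each value occurs once. *)
Lemma G_le_perimeter {R : realType} {X : Type} {G : X -> X -> X -> R}
    (hG : G_metric G) (x y z : X) :
  3 * G x y z <= Gdist G x y + Gdist G y z + Gdist G z x.
Proof.
have hy := G_rectangle hG x y z y.
have hz := G_rectangle hG y z x z.
have hx := G_rectangle hG z x y x.
have [_ _ eyz ezx _] := G_sym hG x y z.
have [_ _ ey _ _] := G_sym hG y y z.
have [_ _ _ ey' _] := G_sym hG y y z.
have [_ _ _ ez _] := G_sym hG z z x.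
have [_ _ _ ex _] := G_sym hG x x y.
rewrite /Gdist; lra.
Qed.

(** * Orbits of a cyclical operator *)

Lemma val_iter_ordS (m : nat) (i : 'I_m) (k : nat) :
  iter k (@ordS m) i = ((i + k) %% m)%N :> nat.
Proof.
elim: k => [|k IH] /=; first by rewrite addn0 modn_small.
by rewrite IH -addn1 modnDml addn1 addnS.
Qed.

Lemma iter_ordS_cycle (m : nat) (i : 'I_m) (N : nat) :
  iter (N * m) (@ordS m) i = i.
Proof.
by apply: val_inj; rewrite /= val_iter_ordS addnC modnMDl modn_small.
Qed.

Lemma iter_ordS_reach (m : nat) (i j : 'I_m) :
  exists2 k, (k <= m)%N & iter k (@ordS m) i = j.
Proof.
have m0 : (0 < m)%N by apply: leq_ltn_trans (ltn_ord i).
exists ((j + (m - i)) %% m)%N; first by rewrite ltnW // ltn_mod.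
apply: val_inj; rewrite /= val_iter_ordS modnDmr addnCA subnKC 1?ltnW //.
by rewrite modnDr modn_small.
Qed.

Lemma cyclical_iter {X : Type} {m : nat} {Xs : 'I_m -> set X}
    {T : {fun cyclic_union Xs >-> cyclic_union Xs}} (hT : cyclical T)
    {i : 'I_m} {x : X} (k : nat) (hx : Xs i x) :
  Xs (iter k (@ordS m) i) (iter k T x).
Proof. by elim: k => //= k IH; apply: hT; exists (iter k T x). Qed.

(** The hypothesis on [T] for the consecutive pair [(T^k x, T^(k+1) x)]: both
    distances on the right are equal, hence the factor [2 * alpha]. *)
Lemma orbit_step {R : realType} {X : Type} {G : X -> X -> X -> R} {m : nat}
    {Xs : 'I_m -> set X} {alpha : R} (halpha0 : 0 < alpha)
    {T : {fun cyclic_union Xs >-> cyclic_union Xs}}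
    (hT : G_Mohseni_semi_cyclical G alpha T) {i : 'I_m} {x : X} (k : nat)
    (hx : Xs i x) :
  Gdist G (iter k T x) (iter k.+1 T x) <= (2 * alpha) ^+ k * Gdist G x (T x).
Proof.
case: hT => hc hT.
elim: k => [|k IH]; first by rewrite expr0 mul1r.
have := hT _ _ _ (cyclical_iter hc k hx) (cyclical_iter hc k.+1 hx).
rewrite -![_ + _ in leLHS]/(Gdist _ _ _) => /le_trans; apply.
rewrite exprS -mulrA /=.
apply: le_trans (ler_wpM2l _ IH); last by lra.
by rewrite /Gdist /=; lra.
Qed.

Lemma exists_almost_fixed {R : realType} {X : Type} {G : X -> X -> X -> R}
    {m : nat} {Xs : 'I_m -> set X} (hXs : forall i, Xs i !=set0) {alpha : R}
    (halpha0 : 0 < alpha) (halpha1 : alpha < 1 / 2)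
    {T : {fun cyclic_union Xs >-> cyclic_union Xs}}
    (hT : G_Mohseni_semi_cyclical G alpha T) (l : 'I_m) (eta : R)
    (heta : 0 < eta) :
  exists2 w, Xs l w & Gdist G w (T w) <= eta.
Proof.
have [w0 hw0] := hXs l.
have m0 : (0 < m)%N by apply: leq_ltn_trans (ltn_ord l).
have q1 : `|(2 * alpha) ^+ m| < 1.
  by rewrite ger0_norm ?exprn_ge0 ?exprn_ilt1 -?lt0n //; lra.
have := cvg_geometric (Gdist G w0 (T w0)) q1.
move=> /cvgrPdist_le /(_ _ heta) [N _ /(_ N (leqnn N))] /=.
rewrite sub0r normrN => hN.
exists (iter (N * m) T w0).
  by rewrite -[l](@iter_ordS_cycle m l N); apply: cyclical_iter => //; case: hT.
apply: le_trans (orbit_step halpha0 hT (N * m) hw0) _.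
rewrite mulnC exprM mulrC; exact: le_trans (ler_norm _) hN.
Qed.

Lemma Gdist_iter {R : realType} {X : Type} {G : X -> X -> X -> R}
    (hG : G_metric G) {m : nat} {Xs : 'I_m -> set X} {alpha : R}
    (halpha0 : 0 < alpha) (halpha1 : alpha < 1 / 2)
    {T : {fun cyclic_union Xs >-> cyclic_union Xs}}
    (hT : G_Mohseni_semi_cyclical G alpha T) {i : 'I_m} {w : X} (k : nat)
    (hw : Xs i w) :
  Gdist G w (iter k T w) <= k%:R * Gdist G w (T w).
Proof.
elim: k => [|k IH]; first by rewrite /= Gdistxx // mul0r.
apply: le_trans (Gdist_triangle hG (iter k T w) _ _) _.
rewrite -natr1 mulrDl mul1r lerD //.
apply: le_trans (orbit_step halpha0 hT k hw) _.
by rewrite ler_piMl ?Gdist_ge0 // exprn_ile1 //; lra.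
Qed.

(** * Distance between approximate fixed points *)

(** The operator is applied to the pair [(w, x)], so its displacement term is
    that of [w]; solving
    [d w x <= d w (T w) + alpha * (d w x + d w (T w)) + d x (T x)]
    for [d w x] therefore leaves [d x (T x)] with the coefficient [1] only. *)
Lemma Gdist_almost_fixed {R : realType} {X : Type} {G : X -> X -> X -> R}
    (hG : G_metric G) {m : nat} {Xs : 'I_m -> set X} {alpha : R}
    {T : {fun cyclic_union Xs >-> cyclic_union Xs}}
    (hT : G_Mohseni_semi_cyclical G alpha T) {l : 'I_m} {w x : X}
    (hw : Xs l w) (hx : Xs (ordS l) x) :
  (1 - alpha) * Gdist G w x <=
    (1 + alpha) * Gdist G w (T w) + Gdist G x (T x).
Proof.
have := proj2 hT _ _ _ hw hx.
rewrite -!/(Gdist G _ _) => h.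
have h1 := Gdist_triangle hG (T w) w x.
have h2 := Gdist_triangle hG (T x) (T w) x.
rewrite (GdistC G (T x) x) in h2.
lra.
Qed.

Lemma Gdist_eps_fixed {R : realType} {X : Type} {G : X -> X -> X -> R}
    (hG : G_metric G) {m : nat} {Xs : 'I_m -> set X}
    (hXs : forall i, Xs i !=set0) {alpha : R}
    (halpha0 : 0 < alpha) (halpha1 : alpha < 1 / 2)
    {T : {fun cyclic_union Xs >-> cyclic_union Xs}}
    (hT : G_Mohseni_semi_cyclical G alpha T) {eps : R} (heps : 0 < eps)
    {x y : X} (hx : eps_fixed G T eps x) (hy : eps_fixed G T eps y) :
  Gdist G x y <= eps * ((2 + alpha) / (1 - alpha)).
Proof.
case: hx hy => -[i _ hx]; rewrite -/(Gdist G x (T x)) => dx.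
case=> -[j _ hy]; rewrite -/(Gdist G y (T y)) => dy.
(* The errors add up to at most [4 * eta / (1 - alpha)] from the two
   comparisons and [m * eta] from the orbit of [w]; this value of [eta] makes
   them fit into [alpha * eps / (1 - alpha)]. *)
pose eta := eps * alpha / (4 + m%:R).
have m_ge0 : 0 <= m%:R :> R by [].
have heta : 0 < eta by rewrite divr_gt0 ?mulr_gt0 //; lra.
have etaE : eta * (4 + m%:R) = eps * alpha by rewrite /eta divfK //; lra.
have [w hw dw] := exists_almost_fixed hXs halpha0 halpha1 hT (ord_pred i) _ heta.
have [k km kE] := iter_ordS_reach _ (ord_pred i) (ord_pred j).
have hw' := cyclical_iter (proj1 hT) k hw.
have dw' : Gdist G (iter k T w) (T (iter k T w)) <= eta.
  apply: le_trans (orbit_step halpha0 hT k hw) (le_trans _ dw).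
  by rewrite ler_piMl ?Gdist_ge0 // exprn_ile1 //; lra.
have dww' : Gdist G w (iter k T w) <= m%:R * eta.
  apply: le_trans (Gdist_iter hG halpha0 halpha1 hT k hw) _.
  by rewrite ler_pM ?Gdist_ge0 // ler_nat.
rewrite -[i]ord_predK in hx; rewrite -[j]ord_predK -kE in hy.
have hwx := Gdist_almost_fixed hG hT hw hx.
have hwy := Gdist_almost_fixed hG hT hw' hy.
have tri1 := Gdist_triangle hG w x y.
have tri2 := Gdist_triangle hG (iter k T w) w y.
rewrite (GdistC G x w) in tri1.
have a1 : 0 < 1 - alpha by lra.
rewrite mulrA ler_pdivlMr //.
have a2 : 0 <= 1 + alpha by lra.
have e1 := ler_wpM2l a2 dw.
have e2 := ler_wpM2l a2 dw'.
have e3 := ler_wpM2l (ltW a1) dww'.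
have e4 := ler_wpM2l (ltW a1) (le_trans tri1 (lerD (lexx _) tri2)).
have e5 : alpha * (m%:R * eta) >= 0 by rewrite !mulr_ge0 // ltW.
have e6 : alpha * eta <= eta by rewrite ler_piMl ?(ltW heta) //; lra.
lra.
Qed.

Theorem theorem5p5 (R : realType) (X : Type) (G : X -> X -> X -> R)
    (hG : G_metric G) (m : nat) (hm : (1 <= m)%N) (Xs : 'I_m -> set X)
    (hXs : forall i, Xs i !=set0) (alpha : R)
    (halpha0 : 0 < alpha) (halpha1 : alpha < 1 / 2)
    (T : {fun cyclic_union Xs >-> cyclic_union Xs})
    (hT : G_Mohseni_semi_cyclical G alpha T) (eps : R) (heps : 0 < eps) :
  (G_diameter G (eps_fixed G T eps)
     <= (eps * ((2 + alpha) / (1 - alpha)))%:E)%E.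
Proof.
apply: ge_ereal_sup => _ [x [y [z [hx hy hz ->]]]]; rewrite lee_fin.
have := G_le_perimeter hG x y z.
have := Gdist_eps_fixed hG hXs halpha0 halpha1 hT heps hx hy.
have := Gdist_eps_fixed hG hXs halpha0 halpha1 hT heps hy hz.
have := Gdist_eps_fixed hG hXs halpha0 halpha1 hT heps hz hx.
lra.
Qed.
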